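(* For every integer $k\ge3$ and every item sequence $I\in(0,1]^n$, $MM_k(I)\le\left(\lambda_k-\frac1k\right)\cdot OPT_k(I)+k$.
   Context: Define $\pi_1=2$, $\pi_{i+1}=\pi_i(\pi_i-1)+1$ for $i\ge1$, and $\lambda_j=\sum_{i=1}^j\max\{\frac{1}{\pi_i-1},\frac1j\}$ for $j\ge1$. The $k$-cardinality constrained bin packing problem: an item sequence $I\in(0,1]^n$ must be packed into bins of capacity $1$ with at most $k$ items per bin; $OPT_k(I)$ is the minimum number of non-empty bins, and $ALG(I)$ the number of non-empty bins used by $ALG$. Algorithm $MM_k$: sort the items in non-increasing order; keep a single open bin with load $S$. Repeat while items remain: if the open bin already contains $k$ items, close it and open a new bin; else if the head (largest remaining) item fits ($S+\text{head}\le1$) pack it; else if the tail (smallest remaining) item fits pack it; else close the open bin permanently and open a new empty bin. *)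

(* Defs.v *)
From HB Require Import structures.
From mathcomp Require Import all_boot all_order all_algebra.
From mathcomp Require Import reals.
Set Implicit Arguments. Unset Strict Implicit. Unset Printing Implicit Defensive.
Import Order.TTheory GRing.Theory Num.Theory.
Local Open Scope ring_scope.

Fixpoint sylv (n : nat) : nat :=
  match n with
  | 0 => 2
  | n'.+1 => (sylv n' * (sylv n').-1 + 1)%N
  end.
Definition pi_seq (i : nat) : nat := sylv i.-1.

Definition lambda {R : realType} (j : nat) : R :=
  \sum_(1 <= i < j.+1) Num.max ((pi_seq i).-1%:R)^-1 (j%:R)^-1.

Section BinPacking.
Variable R : realType.

(* A packing of the items of s with bin labels in 'I_(size s) (at most
   size s bins are ever non-empty).  Feasible: every bin has at most k
   items and total size at most 1. *)
Definition feasible (k : nat) (s : seq R)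
    (f : {ffun 'I_(size s) -> 'I_(size s)}) : bool :=
  [forall b : 'I_(size s),
     (#|[set i | f i == b]| <= k)%N && (\sum_(i | f i == b) s`_i <= 1)].

Definition nbins (s : seq R) (f : {ffun 'I_(size s) -> 'I_(size s)}) : nat :=
  #|[set f i | i : 'I_(size s)]|.

Definition OPT (k : nat) (s : seq R) : nat :=
  \big[minn/size s]_(f : {ffun 'I_(size s) -> 'I_(size s)} | feasible k f)
     nbins f.

(* One run of MM_k on the (sorted) remaining items l, open bin with load S
   and c items; returns the number of non-empty bins used (including the
   currently open one).  head = first element of l, tail = last element. *)
Fixpoint mm_run (fuel k : nat) (l : seq R) (S : R) (c : nat) : nat :=
  match fuel with
  | 0 => ((c > 0) + size l)%N   (* never reached with enough fuel *)
  | fuel'.+1 =>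
    match l with
    | [::] => nat_of_bool (c > 0)%N
    | x :: l' =>
      if c == k then ((c > 0) + mm_run fuel' k l 0 0)%N
      else if S + x <= 1 then mm_run fuel' k l' (S + x) c.+1
      else if S + last x l' <= 1 then mm_run fuel' k (belast x l') (S + last x l') c.+1
      else ((c > 0) + mm_run fuel' k l 0 0)%N
    end
  end.

(* MM_k: sort non-increasingly, then run; 2n+2 steps always suffice
   (each step packs an item or closes a bin, and a close is always
   followed by a pack when items lie in (0,1] and k >= 1). *)
Definition MM (k : nat) (s : seq R) : nat :=
  mm_run ((size s).*2.+2) k (sort (fun x y : R => y <= x) s) 0 0.

End BinPacking.

(* Main.v *)
Require Import Defs.
From HB Require Import structures.
From mathcomp Require Import all_boot all_order all_algebra.
From mathcomp Require Import reals.
From mathcomp Require Import zify ring lra.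
Set Implicit Arguments. Unset Strict Implicit. Unset Printing Implicit Defensive.
Import Order.TTheory GRing.Theory Num.Theory.
Local Open Scope ring_scope.

(** Give an item [x] the weight [1 / min (k, floor (1 / x))]. A bin of [MM_k]
consists of "heads" (largest items) followed by "tails" (smallest items).
The heads of a bin weigh at least [1], except for at most one bin per class
[2, ..., k], so [MM_k] is at most [k - 1] plus the weight of the heads, i.e. plus
the total weight minus at least [1 / k] per tail.

An optimal bin weighs at most [lambda k], and even [lambda k - 1 / k] unless it
contains an item above [1 / 2] together with another item. The number of
such exceptional bins exceeds the number of tails by at most one. Indeed, for
any threshold [t > 1 / 2], each exceptional bin contains an item in [(1 / 2, t)] or
an item of size at most [1 - t]. Choose for [t] the item above [1 / 2] in
the last bin of [MM_k] that got such an item but no tail: when it closes, all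
items of size at most [1 - t] are already tails, and every later bin with such an
item, except possibly the one that also gets a second head, has a tail. *)

(** * Item classes and weights *)

Section Weight.
Variables (R : realType) (k : nat).
Hypothesis k_gt0 : (0 < k)%N.
Implicit Types (x y : R) (l : seq R) (j N : nat).

Definition cls x : nat := minn k (Num.truncn x^-1).

Definition weight x : R := (cls x)%:R^-1.

Lemma cls_le x : (cls x <= k)%N.
Proof. exact: geq_minl. Qed.

Lemma leq_cls j x : 0 < x -> (j <= cls x)%N = (j <= k)%N && (j%:R * x <= 1).
Proof.
move=> x0; rewrite leq_min; congr (_ && _).
rewrite truncn_ge_nat; last by rewrite invr_ge0 ltW.
by rewrite -[x^-1]mul1r ler_pdivlMr.
Qed.

Lemma cls_gt0 x : 0 < x <= 1 -> (0 < cls x)%N.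
Proof. by case/andP=> x0 x1; rewrite leq_cls// k_gt0 mul1r. Qed.

Lemma le_cls x y : 0 < x -> x <= y -> (cls y <= cls x)%N.
Proof.
move=> x0 xy; rewrite leq_cls// cls_le/=.
have: (cls y <= cls y)%N by [].
rewrite leq_cls ?(lt_le_trans x0)// => /andP[_]; apply: le_trans.
by rewrite ler_wpM2l.
Qed.

Lemma cls_mul_le1 x : 0 < x -> (cls x)%:R * x <= 1.
Proof. by move=> x0; have := leqnn (cls x); rewrite leq_cls// => /andP[]. Qed.

Lemma weight_ge0 x : 0 <= weight x.
Proof. by rewrite invr_ge0. Qed.

Lemma weight_ge x : 0 < x <= 1 -> k%:R^-1 <= weight x.
Proof.
by move=> x01; rewrite lef_pV2 ?posrE ?ltr0n// ?ler_nat ?cls_le ?cls_gt0.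
Qed.

(** With [j = pi_i - 1] the bound is the [i]-th term of [lambda k]; the other argument of the
    maximum covers [j > k], where the cap forces class [k]. *)
Lemma weight_le j x : (0 < j)%N -> 0 < x -> j%:R * x <= 1 ->
  weight x <= Num.max j%:R^-1 k%:R^-1.
Proof.
move=> j0 x0 jx; rewrite le_max.
have [jk|/ltnW kj] := leqP j k; apply/orP; [left|right].
  have jc : (j <= cls x)%N by rewrite leq_cls ?jk.
  by rewrite lef_pV2 ?posrE ?ltr0n ?ler_nat// (leq_trans j0).
have kc : (k <= cls x)%N.
  by rewrite leq_cls ?leqnn//= (le_trans _ jx)// ler_wpM2r ?ler_nat// ltW.
by rewrite lef_pV2 ?posrE ?ltr0n ?ler_nat// (leq_trans k_gt0).
Qed.

Lemma weight_small x : 0 < x -> k%:R * x <= 1 -> weight x <= k%:R^-1.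
Proof. by move=> x0 kx; have := weight_le k_gt0 x0 kx; rewrite maxxx. Qed.

(** Let [c] be the class of [x]. As [1 < k x], the cap is not active, so [(c + 1) x > 1] and
    [1 / c < (c + 1) / c * x]; this factor decreases in [c], and [c >= N]. *)
Lemma weight_density N x : (0 < N)%N -> 0 < x -> N%:R * x <= 1 ->
  1 < k%:R * x -> weight x <= (N%:R + 1) / N%:R * x.
Proof.
move=> N0 x0 Nx kx.
have Nk : (N <= k)%N.
  rewrite -(ler_nat R) -(ler_pM2r x0); apply: le_trans Nx _; exact: ltW.
have Nc : (N <= cls x)%N by rewrite leq_cls ?Nk.
have c0 : (0 < cls x)%N by apply: leq_trans Nc.
have ck : (cls x < k)%N.
  by rewrite ltnNge leq_cls// leqnn/= -ltNge.
have cx : 1 < (cls x)%:R * x + x.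
  have := ltnn (cls x); rewrite -/(leq _ _) leq_cls// ck/= => /negbT.
  by rewrite -ltNge -natr1 mulrDl mul1r.
rewrite /weight; set c : R := (cls x)%:R.
have cR : 0 < c by rewrite ltr0n.
have NR : 0 < N%:R :> R by rewrite ltr0n.
have NcR : N%:R <= c by rewrite ler_nat.
rewrite mulrAC ler_pdivlMr// mulrC -ler_pdivlMr ?invr_gt0// invrK.
rewrite -/c in cx.
have : 0 <= (c - N%:R) * x by rewrite mulr_ge0 ?subr_ge0// ltW.
have : 0 <= N%:R * (c * x + x - 1) by rewrite mulr_ge0 ?subr_ge0// ltW.
nra.
Qed.

(** Items with [k x <= 1] weigh [1 / k] however small they are, so no density bound covers them:
    they are charged by number, the others by size or at [1 / N] each. *)
Lemma sum_weight_flat N l : (0 < N)%N ->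
  all (fun x => (0 < x) && (N%:R * x <= 1)) l ->
  let big := count (fun x => 1 < k%:R * x) l in
  \sum_(x <- l) weight x <=
    (N%:R + 1) / N%:R * (\sum_(x <- l) x) + (size l - big)%N%:R / k%:R
  /\ \sum_(x <- l) weight x <= big%:R / N%:R + (size l - big)%N%:R / k%:R.
Proof.
move=> N0; elim: l => [|x l IH]; first by rewrite !big_nil/= !mul0r mulr0 addr0.
move=> /= /andP[/andP[x0 Nx] /IH [IH1 IH2]]; rewrite !big_cons.
have NR : 0 < N%:R :> R by rewrite ltr0n.
have kR : 0 < k%:R :> R by rewrite ltr0n.
have cs := count_size (fun x => 1 < k%:R * x) l.
have [kx|kx] := ltP.
  rewrite add1n subSS mulrDr -addrA; split.
    by apply: lerD => //; apply: weight_density.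
  rewrite -nat1r mulrDl mul1r -addrA; apply: lerD => //.
  have Nk : (N <= k)%N.
    by rewrite -(ler_nat R) -(ler_pM2r x0); apply: le_trans Nx _; exact: ltW.
  apply: le_trans (weight_le N0 x0 Nx) _.
  by rewrite ge_max lexx/= lef_pV2 ?posrE// ler_nat.
rewrite add0n subSn// -natr1 !mulrDl mul1r mulrDr.
have wx := weight_small x0 kx.
have ? : 0 <= (N%:R + 1) / N%:R * x.
  by rewrite mulr_ge0 ?ltW// divr_gt0// ltr_wpDr.
by split; lra.
Qed.

(** * Sylvester's sequence and the bound [lambda k] on the weight of a bin *)

Lemma sylv_gt1 i : (1 < sylv i)%N.
Proof. by elim: i => //= i IH; case: (sylv i) IH => [|[|n]] //= _; nia. Qed.

Lemma sylvS_pred i : (sylv i.+1).-1 = (sylv i * (sylv i).-1)%N.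
Proof. by rewrite /= addn1. Qed.

Lemma sylv_pred_gt0 i : (0 < (sylv i).-1)%N.
Proof. by have := sylv_gt1 i; case: (sylv i) => [|[]]. Qed.

Definition sylv_term i : R := Num.max ((sylv i).-1%:R)^-1 (k%:R)^-1.

Lemma sylv_term_ge i : k%:R^-1 <= sylv_term i.
Proof. by rewrite le_max lexx orbT. Qed.

Lemma sylv_term_gt0 i : 0 < sylv_term i.
Proof. by apply: lt_le_trans (sylv_term_ge i); rewrite invr_gt0 ltr0n. Qed.

Lemma sum_sylv_term_ge r n : n%:R / k%:R <= \sum_(r <= i < r + n) sylv_term i.
Proof.
rewrite -[X in X%:R](addKn r) mulrC mulr_natr -sumr_const_nat.
by apply: ler_sum => i _; exact: sylv_term_ge.
Qed.

(* The first two terms add up to exactly the density bound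
   [(N + 1) / N] of items of size at most [1 / N], times the room [1 / (N - 1)]. *)
Lemma sum_weight_sylv_flat r l : all (fun x => (0 < x) && ((sylv r)%:R * x <= 1)) l ->
  \sum_(x <- l) x <= ((sylv r).-1)%:R^-1 ->
  \sum_(x <- l) weight x <= \sum_(r <= i < r + size l) sylv_term i.
Proof.
have N0 : (0 < sylv r)%N by apply: ltnW (sylv_gt1 r).
move=> lP lS; have [] := sum_weight_flat N0 lP.
set b := count _ l; have bs : (b <= size l)%N by apply: count_size.
have M0 := sylv_pred_gt0 r.
have NR : 0 < (sylv r)%:R :> R by rewrite ltr0n.
have MR : 0 < (sylv r).-1%:R :> R by rewrite ltr0n.
move=> F1 F2; case: (posnP b) => [b0|b_gt0].
  apply: le_trans F2 _; rewrite b0 mul0r add0r subn0; exact: sum_sylv_term_ge.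
have s0 : (0 < size l)%N by apply: leq_trans bs.
rewrite big_ltn; last by rewrite -addn1 leq_add2l.
(* A lone big item is charged [1 / N], which the first term covers; the density bound serves for two
   or more. *)
have [b1|b1] := leqP b 1.
  have {}b1 : b = 1%N by lia.
  apply: le_trans F2 _; rewrite b1 mul1r; apply: lerD.
    rewrite le_max; apply/orP; left.
    by rewrite lef_pV2 ?posrE// ler_nat leq_pred.
  by rewrite subn1 (_ : r + size l = r.+1 + (size l).-1)%N ?sum_sylv_term_ge//; lia.
rewrite big_ltn; last by lia.
apply: le_trans F1 _; rewrite addrA; apply: lerD; last first.
  apply: le_trans (_ : (size l - 2)%:R / k%:R <= _).
    by rewrite ler_wpM2r ?invr_ge0// ler_nat leq_sub2l.
  by rewrite (_ : r + size l = r.+2 + (size l - 2))%N ?sum_sylv_term_ge//; lia.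
apply: le_trans (_ : ((sylv r).-1)%:R^-1 + ((sylv r.+1).-1)%:R^-1 <= _); last first.
  by apply: lerD; rewrite le_max lexx.
rewrite sylvS_pred natrM invfM.
apply: le_trans (_ : ((sylv r)%:R + 1) / (sylv r)%:R * (sylv r).-1%:R^-1 <= _).
  by rewrite ler_wpM2l// ltW// divr_gt0// ltr_wpDr.
by rewrite mulrDl divff ?gt_eqF// mulrDl mul1r mul1r.
Qed.

(** Induction on the largest item, with [N = sylv r]. If it exceeds [1 / N], the first term covers
    its weight, and the room left is below [1 / (N - 1) - 1 / N = 1 / (N (N - 1))], the room assumed
    for [r.+1]. Otherwise all items are at most [1 / N]. *)
Lemma sum_weight_sylv r l : sorted (fun x y => y <= x) l -> all (> 0) l ->
  \sum_(x <- l) x <= ((sylv r).-1)%:R^-1 ->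
  \sum_(x <- l) weight x <= \sum_(r <= i < r + size l) sylv_term i.
Proof.
elim: l r => [|x l IH] r; first by rewrite !big_nil addn0 big_geq.
move=> lS lP lsum; have /= /andP[x0 lP'] := lP.
have NR : 0 < (sylv r)%:R :> R by rewrite ltr0n; apply: ltnW (sylv_gt1 r).
have MR : 0 < (sylv r).-1%:R :> R by rewrite ltr0n sylv_pred_gt0.
have NM : (sylv r)%:R = (sylv r).-1%:R + 1 :> R.
  by rewrite natr1 prednK// ltnW// sylv_gt1.
have getr : transitive (fun x y : R => y <= x) by move=> a b c /[swap]; exact: le_trans.
have [Nx|Nx] := leP ((sylv r)%:R * x) 1.
  apply: sum_weight_sylv_flat => //=.
  rewrite x0 Nx/=; apply/allP => y yl; rewrite (allP lP')//=.
  apply: le_trans Nx; rewrite ler_wpM2l//.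
  by move: lS; rewrite /= path_sortedE// => /andP[/allP/(_ _ yl)].
rewrite big_cons/= big_ltn; last by rewrite addnS ltnS leq_addr.
move: lsum; rewrite big_cons => lsum.
have sum_ge0 : 0 <= \sum_(y <- l) y.
  by rewrite big_seq sumr_ge0// => y yl; rewrite ltW// (allP lP').
apply: lerD.
  apply: weight_le => //; first exact: sylv_pred_gt0.
  by rewrite mulrC -ler_pdivlMr// mul1r; apply: le_trans lsum; rewrite lerDl.
rewrite -addSnnS; apply: IH => //; first exact: path_sorted lS.
rewrite sylvS_pred natrM invfM.
have -> : (sylv r)%:R^-1 * (sylv r).-1%:R^-1 = (sylv r).-1%:R^-1 - (sylv r)%:R^-1 :> R.
  by rewrite NM; field; rewrite -NM !gt_eqF.
have : (sylv r)%:R^-1 <= x.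
  by rewrite -[_^-1]mul1r ler_pdivrMr// mulrC ltW.
by lra.
Qed.

Lemma lambdaE : lambda k = \sum_(0 <= i < k) sylv_term i.
Proof. by rewrite /lambda big_add1. Qed.

Lemma sum_weight_le_lambda l : all (> 0) l -> (size l <= k)%N ->
  \sum_(x <- l) x <= 1 -> \sum_(x <- l) weight x <= lambda k.
Proof.
move=> lP lk l1; pose s := sort (fun x y : R => y <= x) l.
have ps : perm_eq s l by rewrite perm_sort.
rewrite -(perm_big _ ps)/=; apply: le_trans (@sum_weight_sylv 0 _ _ _ _) _.
- by apply: sort_sorted => x y; exact: le_total.
- by rewrite (perm_all _ ps).
- by rewrite (perm_big _ ps) invr1.
rewrite lambdaE add0n (perm_size ps) (@big_cat_nat _ _ _ (size l) 0 k)//= lerDl.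
by rewrite sumr_ge0// => i _; rewrite ltW ?sylv_term_gt0.
Qed.

Lemma lambda_ge : (2 <= k)%N -> 3 / 2 + (k - 2)%:R / k%:R <= lambda k :> R.
Proof.
move=> k2; rewrite lambdaE big_ltn ?(ltnW k2)// big_ltn// addrA.
apply: lerD.
  apply: le_trans (_ : 1^-1 + 2^-1 <= _); first by lra.
  by apply: lerD; rewrite le_max lexx.
by have := sum_sylv_term_ge 2 (k - 2); rewrite subnKC.
Qed.

(** Items in [(1 / k, 1 / 2]] weigh at most [3 / 2] times their size. With three or more of them,
    the rest weighs at most [(k - 3) / k]; with at most two, each is charged [1 / 2]. *)
Lemma sum_weight_no_large l : (3 <= k)%N ->
  all (fun x => (0 < x) && (x <= 2^-1)) l -> (size l <= k)%N ->
  \sum_(x <- l) x <= 1 -> \sum_(x <- l) weight x <= lambda k - k%:R^-1.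
Proof.
move=> k3 lP lk l1; have := lambda_ge (ltnW k3).
have lP' : all (fun x => (0 < x) && (2%:R * x <= 1)) l.
  by apply: sub_all lP => x /andP[-> /=]; lra.
have [//|] := @sum_weight_flat 2 _ _ lP'.
set b := count _ _ => F1 F2.
have kR : 0 < k%:R :> R by rewrite ltr0n.
have ki : k%:R * k%:R^-1 = 1 :> R by rewrite divff ?gt_eqF.
have k3i : 3 * k%:R^-1 <= 1 :> R.
  by rewrite ler_pdivrMr// mul1r ler_nat.
rewrite natrB 1?ltnW// mulrBl ki.
have le_sub b' : (b' <= k)%N -> (b' <= b)%N ->
    (size l - b)%:R / k%:R <= 1 - b'%:R / k%:R :> R.
  move=> b'k b'b; rewrite -[X in X - _]ki -mulrBl -natrB// ler_wpM2r ?invr_ge0//.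
  by rewrite ler_nat; lia.
move: F1 F2; have [b2|b2] := leqP b 2.
  have bk : (b <= k)%N by lia.
  move=> _; have := le_sub b bk (leqnn _).
  have : b = 0%N \/ b = 1%N \/ b = 2%N by lia.
  by move=> [->|[->|->]]; lra.
move=> F1 _; have := le_sub 3%N k3 b2; lra.
Qed.

Definition narrow_count (t : R) l : nat :=
  (count (fun x => (2^-1 < x < t)%R) l + count (fun x => (x <= 1 - t)%R) l)%N.

(* A bin heavier than [lambda k - 1/k] contains an item above [1/2] and some other
   item; one of these two is counted by [narrow_count], whatever [t] is. *)
Lemma sum_weight_bin t l : (3 <= k)%N -> all (> 0) l -> (size l <= k)%N ->
  \sum_(x <- l) x <= 1 ->
  \sum_(x <- l) weight x - (narrow_count t l)%:R / k%:R <= lambda k - k%:R^-1.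
Proof.
move=> k3 lP lk l1.
have kR : 0 < k%:R^-1 :> R by rewrite invr_gt0 ltr0n.
have [nl|] := boolP (all (fun x => x <= 2^-1) l).
  apply: le_trans (_ : \sum_(x <- l) weight x <= _).
    by rewrite gerBl divr_ge0.
  by apply: sum_weight_no_large => //; rewrite all_predI lP.
rewrite -has_predC => /hasP[x xl /=]; rewrite -ltNge => x_large.
have pl := perm_to_rem xl.
(* With nothing counted, [x >= t], so a second item would be at most [1 - t] and counted. Hence [x]
   is alone and weighs at most [1]. *)
have [e0|] := posnP (narrow_count t l).
  have x0 := allP lP _ xl.
  have : rem x l = [::].
    move: l1 e0; rewrite /narrow_count !(permP pl) (perm_big _ pl)/= big_cons.
    case: (rem x l) (perm_all (> 0) pl) => //= y l'.
    rewrite lP big_cons => /esym/and3P[_ y0 l'P] l1.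
    have : 0 <= \sum_(z <- l') z.
      by rewrite big_seq sumr_ge0// => z zl; rewrite ltW// (allP l'P).
    rewrite x_large/=; have [xt //|tx] := ltP x t.
    move=> s_ge0; have -> : y <= 1 - t by lra.
    by move/eqP; rewrite !addn_eq0/= !andbF.
  move=> re; rewrite e0 mul0r subr0 (perm_big _ pl)/= re big_seq1.
  apply: le_trans (_ : 1 <= _).
    rewrite invf_le1 ?ltr0n ?ler1n; apply: cls_gt0;
      move: l1; rewrite (perm_big _ pl)/= re big_seq1 => ->; by rewrite x0.
  have := lambda_ge (ltnW k3); rewrite natrB 1?ltnW// mulrBl divff ?pnatr_eq0 -?lt0n//.
  have : 3 * k%:R^-1 <= 1 :> R.
    by rewrite ler_pdivrMr ?ltr0n// mul1r ler_nat.
  lra.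
move=> e0; apply: lerB; first exact: sum_weight_le_lambda.
by rewrite ler_peMl ?ler1n// ltW.
Qed.

End Weight.

(** * Bin-by-bin analysis of a run of [MM_k] *)

Section Run.
Variables (R : realType) (k : nat).
Implicit Types (x S : R) (l hs ts : seq R).

Lemma mm_run_nil fuel S : mm_run fuel k [::] S 0 = 0%N.
Proof. by case: fuel. Qed.

(** The load only grows, so a head that fails to fit never fits later, and only tails are packed
    from then on. The fuel bound is strict while the bin is open: one step is kept for closing
    it. *)
Lemma mm_run_tails fuel l S c : all (> 0) l -> ((size l).*2 < fuel)%N ->
  (0 < c <= k)%N -> S <= 1 -> [\/ c = k, l = [::] | 1 < S + head 0 l] ->
  exists l' ts fuel', [/\ l = l' ++ ts, ((size l').*2 <= fuel')%N,
    mm_run fuel k l S c = (mm_run fuel' k l' 0 0).+1,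
    S + \sum_(x <- ts) x <= 1 &
    [\/ ts <> [::], c = k, l' = [::] | 1 < S + last 0 l']].
Proof.
elim: fuel l S c => // fuel IH [|x l] S c lP lf /andP[c0 ck] S1 stop.
  by exists [::], [::], fuel; rewrite mm_run_nil big_nil addr0/= c0; split=> //; constructor 3.
rewrite [mm_run _ _ _ _ _]/=; have [cEk|cNk] := eqVneq c k.
  by exists (x :: l), [::], fuel; rewrite cats0 big_nil addr0 c0; split=> //; constructor 2.
have Sx : 1 < S + x by case: stop => // cEk; rewrite cEk eqxx in cNk.
rewrite leNgt Sx/=; have [Sl|lS] := leP; last first.
  by exists (x :: l), [::], fuel; rewrite cats0 big_nil addr0 c0; split=> //; constructor 4.
have lP' : all (> 0) (rcons (belast x l) (last x l)) by rewrite -lastI.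
move: lP'; rewrite all_rcons => /andP[last_gt0 belastP].
have [||//|//|l' [ts [fuel' [bE l'f -> S1' _]]]] := IH (belast x l) (S + last x l) c.+1 belastP.
- by rewrite size_belast; move: lf => /=; lia.
- by rewrite /= ltn_neqAle cNk ck.
- case: (l) last_gt0 => [|y l2] last_gt0; first by constructor 2.
  by constructor 3 => /=; rewrite addrAC ltr_wpDr// ltW.
exists l', (rcons ts (last x l)), fuel'; split=> //.
  by rewrite lastI bE rcons_cat.
  by rewrite -cats1 big_cat/= big_seq1; lra.
by constructor 1; case: (ts).
Qed.

Lemma mm_run_heads fuel l S c : all (> 0) l -> ((size l).*2 < fuel)%N ->
  (0 < c <= k)%N -> S <= 1 ->
  exists hs l' ts fuel', [/\ l = hs ++ l' ++ ts /\ ((size l').*2 <= fuel')%N,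
    mm_run fuel k l S c = (mm_run fuel' k l' 0 0).+1,
    S + \sum_(x <- hs) x + \sum_(x <- ts) x <= 1,
    [\/ (c + size hs)%N = k, l' = [::] | 1 < S + \sum_(x <- hs) x + head 0 l'] &
    [\/ ts <> [::], (c + size hs)%N = k, l' = [::] |
        1 < S + \sum_(x <- hs) x + last 0 l']].
Proof.
elim: fuel l S c => // fuel IH l S c lP lf /andP[c0 ck] S1.
have [headsL|] : [\/ c = k, l = [::] | 1 < S + head 0 l] \/
    (c != k /\ exists x l2, l = x :: l2 /\ S + x <= 1).
  have [|cNk] := eqVneq c k; first by left; constructor 1.
  case: (l) => [|x l2]; first by left; constructor 2.
  by have [Sx|Sx] := leP (S + x) 1; [right; split=> //; exists x, l2|left; constructor 3].
- have ck' : (0 < c <= k)%N by rewrite c0.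
  have [l' [ts [fuel' [lE l'f -> S1' stop]]]] := mm_run_tails lP lf ck' S1 headsL.
  exists [::], l', ts, fuel'; rewrite big_nil addr0 addn0; split=> //.
  (* The tails may have used up the head that did not fit; then [l'] is empty. *)
  case: headsL; [by constructor 1| |rewrite lE].
    by rewrite lE; case: (l') => // _; constructor 2.
  by case: (l') => [|y l2]; [constructor 2|constructor 3].
case=> cNk [x [l2 [lE Sx]]]; rewrite lE in lP lf *.
have /andP[x0 l2P] := lP.
have [|||hs [l' [ts [fuel' [[l2E l'f] rE S1' stop1 stop2]]]]] := IH l2 (S + x) c.+1 l2P.
- by move: lf => /=; lia.
- by rewrite /= ltn_neqAle cNk ck.
- by [].
exists (x :: hs), l', ts, fuel'; rewrite big_cons addrA/= addnS -addSn; split=> //.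
- by rewrite l2E.
- by rewrite (negPf cNk) Sx rE.
Qed.

Lemma mm_run_bin fuel x l : all (> 0) (x :: l) -> x <= 1 -> (0 < k)%N ->
  ((size (x :: l)).*2 <= fuel)%N ->
  exists hs l' ts fuel', [/\ l = hs ++ l' ++ ts /\ ((size l').*2 <= fuel')%N,
    mm_run fuel k (x :: l) 0 0 = (mm_run fuel' k l' 0 0).+1,
    x + \sum_(y <- hs) y + \sum_(y <- ts) y <= 1,
    [\/ (size hs).+1 = k, l' = [::] | 1 < x + \sum_(y <- hs) y + head 0 l'] &
    [\/ ts <> [::], (size hs).+1 = k, l' = [::] |
        1 < x + \sum_(y <- hs) y + last 0 l']].
Proof.
move=> /= /andP[x0 lP] x1 k0; case: fuel => // fuel lf.
have [||//|hs [l' [ts [fuel' [? rE ? ? ?]]]]] := @mm_run_heads fuel l x 1 lP.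
- by move: lf => /=; lia.
- by rewrite k0.
have k_neq0 : (0%N == k) = false by case: (k) k0.
by exists hs, l', ts, fuel'; split=> //=; rewrite k_neq0 add0r x1.
Qed.

(* Bins whose heads weigh less than [1] end an item class [2, ..., k];
   [deficit l] counts the classes that may still end in [l]. *)
Definition deficit l : nat :=
  if l is x :: _ then k.+1 - maxn 2 (cls k x) else 0.

(** Classes do not decrease along a sorted list. Either the next bin starts in the class of [x], and
    the heads weigh at least [1], or the class rises and the deficit pays. *)
Lemma deficit_step x hs l : (2 <= k)%N -> all (fun y => 0 < y <= 1) (x :: hs ++ l) ->
  sorted (fun x y => y <= x) (x :: hs ++ l) ->
  [\/ (size hs).+1 = k, l = [::] | 1 < x + \sum_(y <- hs) y + head 0 l] ->
  1 + (deficit l)%:R <=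
    weight k x + \sum_(y <- hs) weight k y + (deficit [:: x])%:R.
Proof.
move=> k2 lP lS stop; have k0 := ltnW k2.
have getr : transitive (fun x y : R => y <= x) by move=> a b c /[swap]; exact: le_trans.
have hs_ge0 : 0 <= \sum_(y <- hs) weight k y by rewrite sumr_ge0// => *; exact: weight_ge0.
have /= /andP[x01] := lP; rewrite all_cat => /andP[hsP lP'].
have [xk x_gt0] := (cls_le k x, cls_gt0 k0 x01).
case: l => [|z l] in lP lS lP' stop *.
  have : 1 <= (deficit [:: x])%:R :> R by rewrite ler1n /=; lia.
  have := weight_ge0 k x; rewrite /=; lra.
move: lS; rewrite /= path_sortedE// all_cat => /andP[/and3P[hsx zx _]].
rewrite sorted_cat_cons// => /andP[hsz _].
have z01 : 0 < z <= 1 by case/andP: lP'.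
have [z0 z1] := andP z01.
have := le_cls k z0 zx; rewrite leq_eqVlt => /orP[/eqP xz|xz]; last first.
  have zk := cls_le k z.
  (* The [maxn 2] in [deficit] merges classes [1] and [2]: leaving class [1] costs nothing, since
     [x] alone then weighs [1]. *)
  have [c1|c2] := leqP (cls k x) 1.
    have c1' : cls k x = 1%N by lia.
    have : (deficit (z :: l))%:R <= (deficit [:: x])%:R :> R by rewrite ler_nat/=; lia.
    have -> : weight k x = 1 by rewrite /weight c1' invr1.
    rewrite /=; lra.
  have : 1 + (deficit (z :: l))%:R <= (deficit [:: x])%:R :> R.
    by rewrite nat1r ler_nat/=; lia.
  have := weight_ge0 k x; rewrite /=; lra.
(* All heads now share the class [c] of [z], so each weighs [1 / c]. A full bin has [k >= c] heads;
   otherwise the heads and [z], each at most [1 / c], exceed [1], so there are at least [c]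
   heads. *)
rewrite /= xz lerD2r.
have cR : 0 < (cls k z)%:R :> R by rewrite ltr0n -xz.
have hz y : y \in hs -> 0 < y /\ (cls k y = cls k z).
  move=> yh; have /andP[y0 y1] := allP hsP _ yh; split=> //.
  have yx : y <= x := allP hsx _ yh.
  have zy : z <= y by move: hsz; rewrite sorted_pairwise// pairwise_rcons => /andP[/allP/(_ _ yh)].
  by apply/eqP; rewrite eqn_leq (le_cls k z0 zy) -xz le_cls.
have xle : x <= (cls k z)%:R^-1.
  by case/andP: x01 => ? ?; rewrite -[_^-1]mul1r ler_pdivlMr// mulrC -xz cls_mul_le1.
have zle : z <= (cls k z)%:R^-1.
  by rewrite -[_^-1]mul1r ler_pdivlMr// mulrC cls_mul_le1.
have sum_cst (c : R) : \sum_(y <- hs) c = (size hs)%:R * c.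
  by rewrite big_const_seq count_predT iter_addr_0 mulr_natl.
have hle : \sum_(y <- hs) y <= (size hs)%:R * (cls k z)%:R^-1.
  rewrite -sum_cst big_seq [leRHS]big_seq; apply: ler_sum => y /hz[y0 yz].
  by rewrite -[_^-1]mul1r ler_pdivlMr// mulrC -yz cls_mul_le1.
have -> : \sum_(y <- hs) weight k y = (size hs)%:R * (cls k z)%:R^-1.
  rewrite -sum_cst; apply: eq_big_seq => y /hz[_ yz].
  by rewrite /weight yz.
rewrite /weight xz -{1}[_^-1]mul1r -mulrDl nat1r ler_pdivlMr// mul1r ler_nat.
case: stop => [-> //||]; first exact: cls_le.
  by [].
move=> /= stop.
have : 1 < ((size hs).+2)%:R * (cls k z)%:R^-1 :> R.
  by rewrite -!nat1r !mulrDl !mul1r; lra.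
by rewrite ltr_pdivlMr// mul1r ltr_nat ltnS.
Qed.

(** The left alternative stands for a threshold above all items. On the right, [has (>= t) l]
    ensures that larger items put in front of [l] are at least [t], hence not counted. *)
Definition narrow (l : seq R) (n : nat) : Prop :=
  (count (> 2^-1) l <= n)%N \/
    exists t, [/\ 2^-1 < t, has (>= t) l & (narrow_count t l <= n)%N].

Lemma count_large0 l : all (<= 2^-1) l -> count (> 2^-1) l = 0%N.
Proof.
move=> lP; apply/eqP; rewrite -leqn0 leqNgt -has_count; apply/hasPn => y yl.
by rewrite -leNgt; exact: (allP lP _ yl).
Qed.

(* A bin [x] without tails closes because [x + y > 1] for all remaining [y];
   then [t := x] works, unless a later bin provides a smaller [t]. *)
Lemma narrow_step x hs l ts n : (2 <= k)%N ->
  all (> 0) (x :: hs ++ l ++ ts) ->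
  sorted (fun x y => y <= x) (x :: hs ++ l ++ ts) ->
  x + \sum_(y <- hs) y + \sum_(y <- ts) y <= 1 ->
  [\/ ts <> [::], (size hs).+1 = k, l = [::] |
      1 < x + \sum_(y <- hs) y + last 0 l] ->
  narrow l n.+1 -> narrow (x :: hs ++ l ++ ts) (n + size ts).+1.
Proof.
move=> k2 lP lS S1 stop C.
have getr : transitive (fun x y : R => y <= x) by move=> a b c /[swap]; exact: le_trans.
have sum_ge0 (s : seq R) : all (> 0) s -> 0 <= \sum_(y <- s) y.
  by move=> sP; rewrite big_seq sumr_ge0// => y ys; rewrite ltW// (allP sP).
have /= /andP[x0] := lP; rewrite !all_cat => /and3P[hsP lP' tsP].
have lx : all (<= x) (hs ++ l ++ ts).
  by move: lS; rewrite /= path_sortedE// => /andP[].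
have [x_small|x_large] := leP x 2^-1.
  left; rewrite count_large0//= x_small/=.
  by apply: sub_all lx => y /le_trans; apply.
(* A second head is at most [1 - x < 1 / 2], and so is all that follows: [x] is the only item above
   [1 / 2]. *)
case: hs => [|y hs] in lP lS S1 stop hsP lx *; last first.
  left; rewrite /= x_large add1n ltnS.
  have /= /andP[y0 /sum_ge0 hs0] := hsP; have ts0 := sum_ge0 _ tsP.
  have y_small : y <= 2^-1 by move: S1; rewrite big_cons; lra.
  move: lS => /= /andP[_]; rewrite path_sortedE// => /andP[ly _].
  rewrite (negPf (_ : ~~ (2^-1 < y))) -?leNgt//= count_large0//.
  by apply: sub_all ly => z /le_trans; apply.
rewrite /= in lP lS stop lx *; rewrite big_nil addr0 in S1 stop.
have [ts0|ts_neq0] := eqVneq ts [::]; last first.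
  have ts_small : all (<= 2^-1) ts.
    apply/allP => z zts; move: S1 (tsP); rewrite (perm_big _ (perm_to_rem zts)).
    rewrite (perm_all _ (perm_to_rem zts))/= big_cons => S1 /andP[_ /sum_ge0].
    lra.
  (* On the left, the first tail pays for [x]. On the right, [x >= t > 1 - t] is not counted, and a
     tail, being at most [1 / 2], is counted at most once. *)
  case: C => [C|[t [t_large lt C]]].
    left; rewrite /= x_large count_cat (count_large0 ts_small) addn0 add1n ltnS.
    by rewrite (leq_trans C)// -addn1 leq_add2l lt0n size_eq0.
  right; exists t; split=> //; first by rewrite /= has_cat lt orbT.
  have tx : t <= x.
    case/hasP: lt => y yl /le_trans; apply.
    by apply: (allP lx); rewrite mem_cat yl.
  have e1 : ((2^-1 < x < t) = false)%R by rewrite [x < t]ltNge tx andbF.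
  have e2 : (x <= 1 - t) = false by apply/negbTE; rewrite -ltNge; lra.
  have e3 : count (fun y => 2^-1 < y < t) ts = 0%N.
    apply/eqP; rewrite -leqn0 -[X in (_ <= X)%N](count_large0 ts_small).
    by apply: sub_count => y /= /andP[].
  rewrite /narrow_count/= e1 e2 !add0n !count_cat e3 addn0 addnA -addSn.
  by rewrite leq_add// count_size.
rewrite {}ts0 in lP lS S1 stop tsP lx *; rewrite cats0 in lP lS lx *; rewrite addn0.
have [->|l0] := eqVneq l [::]; first by left; rewrite /= x_large.
(* The bin holds only [x] and [k >= 2], so it is not full: even the smallest remaining item does not
   fit. *)
have {}stop : 1 < x + last 0 l.
  by case: stop => // [k1|l_nil]; [rewrite -k1 in k2|rewrite l_nil in l0].
have l_ge y : y \in l -> 1 - x < y.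
  move=> yl; apply: lt_le_trans (_ : last 0 l <= _); first by lra.
  case/lastP: (l) yl lS => // s z; rewrite mem_rcons inE last_rcons => /orP[/eqP->//|ys].
  move/path_sorted; rewrite sorted_pairwise// pairwise_rcons => /andP[/allP sz _].
  exact: sz.
right; case: C => [C|[t [t_large lt C]]].
  exists x; split=> //=; first by rewrite lexx.
  rewrite /narrow_count/= ltxx andbF.
  have -> : (x <= 1 - x) = false by apply/negbTE; rewrite -ltNge; lra.
  rewrite (_ : count (fun y => y <= 1 - x) l = 0%N).
    by rewrite add0n !addn0; apply: leq_trans C; apply: sub_count => y /= /andP[].
  apply/eqP; rewrite -leqn0 leqNgt -has_count; apply/hasPn => y yl.
  by rewrite -ltNge l_ge.
exists t; split=> //=; first by rewrite lt orbT.
have tx : t <= x by case/hasP: lt => y yl /le_trans; apply; exact: (allP lx).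
have e2 : (x <= 1 - t) = false by apply/negbTE; rewrite -ltNge; lra.
by rewrite /narrow_count/= [x < t]ltNge tx andbF e2.
Qed.

(** Induction over the bins, with [H] collecting the heads, which pay for the bins, and [T] the
    tails. *)
Lemma mm_run_split fuel l : (2 <= k)%N ->
  all (fun x => 0 < x <= 1) l -> sorted (fun x y => y <= x) l ->
  ((size l).*2 <= fuel)%N ->
  exists H T, [/\ perm_eq l (H ++ T),
    (mm_run fuel k l 0 0)%:R <= \sum_(x <- H) weight k x + (deficit l)%:R &
    narrow l (size T).+1].
Proof.
move=> k2; have k0 := ltnW k2.
have getr : transitive (fun x y : R => y <= x) by move=> a b c /[swap]; exact: le_trans.
have [n] := ubnP (size l); elim: n l fuel => // n IH [|x l] fuel ln lP lS lf.
  by exists [::], [::]; rewrite mm_run_nil big_nil addr0; split=> //; left.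
have xlP : all (> 0) (x :: l) by apply: sub_all lP => y /andP[].
have /= /andP[/andP[x0 x1] lP'] := lP.
have [hs [l' [ts [fuel' [[lE l'f] -> S1 stop1 stop2]]]]] := mm_run_bin xlP x1 k0 lf.
rewrite lE in ln lP lS xlP *.
have sub : subseq (x :: hs ++ l') (x :: hs ++ l' ++ ts).
  by rewrite catA -cat_cons; exact: prefix_subseq.
have all_sub (s1 s2 : seq R) : subseq s1 s2 ->
    all (fun x => 0 < x <= 1) s2 -> all (fun x => 0 < x <= 1) s1.
  by move=> s12 s2P; apply/allP => y /(mem_subseq s12); apply: (allP s2P).
have l'P := all_sub _ _ sub lP; have l'S := subseq_sorted getr sub lS.
have sub' : subseq l' (x :: hs ++ l') by rewrite -cat_cons; exact: suffix_subseq.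
have [|H' [T' [pl' W' C']]] :=
    IH l' fuel' _ (all_sub _ _ sub' l'P) (subseq_sorted getr sub' l'S) l'f.
  by move: ln; rewrite /= !size_cat; lia.
exists (x :: hs ++ H'), (T' ++ ts); split.
- by rewrite /= perm_cons -!catA perm_cat2l catA perm_cat2r.
- rewrite big_cons big_cat/= -nat1r.
  have := deficit_step k2 l'P l'S stop1; rewrite /=; lra.
- by rewrite size_cat; apply: narrow_step.
Qed.

End Run.

(** * Comparison with an optimal packing *)

Lemma MM_le (R : realType) (k : nat) (s : seq R) : (2 <= k)%N ->
  all (fun x => 0 < x <= 1) s -> exists t,
  (MM k s)%:R <= \sum_(x <- s) weight k x - (narrow_count t s)%:R / k%:R + k%:R.
Proof.
move=> k2 sP; rewrite /MM; set l := sort _ s; set fuel := _.+2.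
have k0 := ltnW k2; have kR : 0 < k%:R :> R by rewrite ltr0n.
have ls : perm_eq l s by rewrite perm_sort.
have lP : all (fun x => 0 < x <= 1) l by rewrite (perm_all _ ls).
have lS : sorted (fun x y => y <= x) l by apply: sort_sorted => x y; exact: le_total.
have lf : ((size l).*2 <= fuel)%N by rewrite (perm_size ls) ltnW.
have [H [T [pl run_le C]]] := mm_run_split k2 lP lS lf.
have [t tC] : exists t, (narrow_count t l <= (size T).+1)%N.
  case: C => [C|[t [_ _ C]]]; last by exists t.
  (* The threshold [2] exceeds every item, and no item is at most [1 - 2]. *)
  exists 2; apply: leq_trans C; rewrite /narrow_count.
  rewrite (_ : count (fun x => x <= 1 - 2) l = 0%N).
    by rewrite addn0; apply: sub_count => x /andP[].
  apply/eqP; rewrite -leqn0 leqNgt -has_count; apply/hasPn => x xl.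
  by have /andP[x0 _] := allP lP _ xl; rewrite -ltNge; lra.
exists t; rewrite -(perm_big _ ls) /narrow_count -!(permP ls) -/(narrow_count t l).
rewrite (perm_big _ pl) big_cat/=; apply: le_trans run_le _.
(* The tails pay for all narrow items but one; its [1 / k <= 1] and the deficit, at most [k - 1],
   make up the constant [k]. *)
have T_ge : (size T)%:R / k%:R <= \sum_(x <- T) weight k x.
  rewrite mulr_natl -[size T]count_predT -iter_addr_0 -big_const_seq.
  rewrite big_seq [leRHS]big_seq; apply: ler_sum => x xT; apply: weight_ge => //.
  by apply: (allP lP); rewrite (perm_mem pl) mem_cat xT orbT.
have : (narrow_count t l)%:R / k%:R <= (size T)%:R / k%:R + k%:R^-1 :> R.
  rewrite -[X in _ + X]mul1r -mulrDl natr1.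
  by rewrite ler_wpM2r ?invr_ge0 ?ler_nat// ltW.
have : (deficit k l)%:R + 1 <= k%:R :> R.
  by rewrite natr1 ler_nat /deficit; case: (l) => [|x l'] //; lia.
have : k%:R^-1 <= 1 :> R by rewrite invf_le1// ler1n.
lra.
Qed.

(** Weight and [narrow_count] are both sums over items, so the corrected weight [G] splits over the
    non-empty bins. *)
Lemma sum_weight_packing (R : realType) (k : nat) (s : seq R) (t : R)
    (f : {ffun 'I_(size s) -> 'I_(size s)}) : (3 <= k)%N ->
  all (> 0) s -> feasible k f ->
  \sum_(x <- s) weight k x - (narrow_count t s)%:R / k%:R <=
    (lambda k - k%:R^-1) * (nbins f)%:R.
Proof.
move=> k3 sP /forallP feas; have k0 : (0 < k)%N by apply: leq_trans k3.
pose G x : R := weight k x - (narrow_count t [:: x])%:R / k%:R.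
have GE l : \sum_(x <- l) weight k x - (narrow_count t l)%:R / k%:R = \sum_(x <- l) G x.
  rewrite /G sumrB -mulr_suml -natr_sum; congr (_ - _%:R / _).
  rewrite /narrow_count big_split/= -!sum1_count.
  by congr addn; rewrite big_mkcond; apply: eq_bigr => x _; rewrite !addn0; case: ifP.
rewrite GE (big_nth 0) big_mkord.
rewrite (partition_big f [in [set f i | i : 'I_(size s)]]); last first.
  by move=> i _; apply: imset_f.
rewrite /= /nbins mulr_natr -sumr_const; apply: ler_sum => b _.
have /andP[bk b1] := feas b; pose e := enum [pred i | f i == b].
have eE F : \sum_(i | f i == b) F s`_i = \sum_(x <- [seq s`_i | i : 'I_(size s) <- e]) F x :> R.
  by rewrite big_map big_enum.
rewrite eE -GE; apply: sum_weight_bin => //.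
- by apply/allP => x /mapP[i _ ->]; apply: (allP sP); exact: mem_nth.
- by rewrite size_map -cardE; move: bk; rewrite cardsE.
- by rewrite -(eE id).
Qed.

Theorem theorem8 (R : realType) (k : nat) (I : seq R) :
  (3 <= k)%N ->
  all (fun x : R => (0 < x) && (x <= 1)) I ->
  (MM k I)%:R <= (lambda (R:=R) k - (k%:R)^-1) * (OPT k I)%:R + k%:R.
Proof.
move=> k3 IP; have [t MMt] := MM_le (ltnW k3) IP.
have I_gt0 : all (> 0) I by apply: sub_all IP => x /andP[].
apply: le_trans MMt _; rewrite lerD2r.
rewrite /OPT; set lhs := _ - _ / _.
apply: (big_ind (fun n => lhs <= _ * n%:R)) => [|m n mP nP|f]; last exact: sum_weight_packing.
(* The default [size I] of the minimum is the bin count of the packing with one item per bin. *)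
- pose f : {ffun 'I_(size I) -> 'I_(size I)} := [ffun i => i].
  have -> : size I = nbins f.
    by rewrite /nbins card_imset ?card_ord// => i j; rewrite !ffunE.
  apply: sum_weight_packing => //; apply/forallP => b.
  have fE : [pred i | f i == b] =1 pred1 b by move=> i /=; rewrite ffunE.
  rewrite cardsE (eq_card fE) card1 (leq_trans _ k3)//=.
  rewrite (eq_bigl _ _ fE) big_pred1_eq.
  by have /andP[] := allP IP _ (mem_nth 0 (ltn_ord b)).
- by rewrite /minn; case: ifP.
Qed.
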